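(* Let $(L,A)$ be a Lie pair, $E$ an $A$-module, and $\nabla$ an $L$-connection on $E$ extending its $A$-action. Let $R^\nabla_E\in\Gamma(A^*\otimes A^\perp\otimes\operatorname{End}E)$ be defined by $$R^\nabla_E(a;q(l))=\nabla_a\nabla_l-\nabla_l\nabla_a-\nabla_{[a,l]},\qquad a\in\Gamma(A),\ l\in\Gamma(L).$$ Then: (a) $R^\nabla_E$ is a $1$-cocycle for the Lie algebroid $A$ with values in the $A$-module $A^\perp\otimes\operatorname{End}E$. (b) The cohomology class $\alpha_E\in H^1(A,A^\perp\otimes\operatorname{End}E)$ of the $1$-cocycle $R^\nabla_E$ does not depend on the choice of the $L$-connection extending the $A$-action. (c) The class $\alpha_E$ vanishes if and only if there exists an $A$-compatible $L$-connection on $E$.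
   Context: Lie algebroids and vector bundles are smooth, real or complex. A Lie pair $(L,A)$ is a Lie algebroid $L\to M$ with a Lie subalgebroid $A$ over the same base $M$. An $A$-module is a vector bundle with a flat $A$-connection. $q:L\to L/A$ is the projection; $L/A$ is an $A$-module via $\nabla_a(q(l))=q([a,l])$, and $A^\perp\cong(L/A)^*$, the annihilator of $A$ in $L^*$, carries the dual action; $A^\perp\otimes\operatorname{End}E$ carries the induced action. $H^\bullet(A,F)$ denotes Lie algebroid cohomology with values in the $A$-module $F$. Since the $A$-connection is flat, the curvature of $\nabla$ vanishes on $\wedge^2A$, so $R^\nabla_E$ is well defined. An $L$-connection $\nabla$ on $E$ is $A$-compatible if it extends the given $A$-action on $E$ and satisfies $\nabla_a\nabla_l-\nabla_l\nabla_a=\nabla_{[a,l]}$ for all $a\in\Gamma(A)$, $l\in\Gamma(L)$. *)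

(* Defs.v *)
From HB Require Import structures.
From mathcomp Require Import all_boot all_order all_algebra complex.
From mathcomp Require Import all_classical all_reals all_analysis.
Import Order.TTheory GRing.Theory Num.Theory.
Import numFieldNormedType.Exports.

Set Implicit Arguments.
Unset Strict Implicit.
Unset Printing Implicit Defensive.

Local Open Scope classical_set_scope.
Local Open Scope ring_scope.

(* Partial derivatives are taken on all of R^n, but at the points of an open   *)
(* set W they only depend on the restriction of f to W.                       *)
Definition iterated_partial (R : realType) (n : nat) (s : seq 'I_n)
    (f : 'rV[R]_n -> R) : 'rV[R]_n -> R :=
  foldr (fun i (h : 'rV[R]_n -> R) => 'D_(delta_mx 0 i) h) f s.

Definition cinfty_on (R : realType) (n : nat) (W : set 'rV[R]_n)
    (f : 'rV[R]_n -> R) : Prop :=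
  forall (s : seq 'I_n) y, W y -> differentiable (iterated_partial s f) y.

(* The inverse of a chart is a total function; its values outside the image   *)
(* of the chart are irrelevant.                                               *)
Record smooth_manifold (R : realType) (n : nat) := SmoothManifold {
  man_space :> topologicalType;
  man_hausdorff : hausdorff_space man_space;
  man_second_countable : @second_countable man_space;
  chart_index : Type;
  chart_dom : chart_index -> set man_space;
  chart : chart_index -> man_space -> 'rV[R]_n;
  chart_inv : chart_index -> 'rV[R]_n -> man_space;
  chart_cover : forall x, exists i, chart_dom i x;
  chart_dom_open : forall i, open (chart_dom i);
  chart_img_open : forall i, open (chart i @` chart_dom i);
  chartK : forall i x, chart_dom i x -> chart_inv i (chart i x) = x;
  chart_continuous : forall i x, chart_dom i x -> {for x, continuous (chart i)};
  chart_inv_continuous : forall i y, (chart i @` chart_dom i) y ->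
    {for y, continuous (chart_inv i)};
  chart_transition : forall i j (k : 'I_n),
    cinfty_on (chart i @` (chart_dom i `&` chart_dom j))
              (fun y => chart j (chart_inv i y) 0 k)
}.

Inductive scalars := RealScalars | ComplexScalars.

Definition scalar_field (R : realType) (g : scalars) : fieldType :=
  match g with
  | RealScalars => R
  | ComplexScalars => R[i]
  end.

Section Smooth.
Context {R : realType} {n : nat} (M : smooth_manifold R n).

Definition smooth_real_on (U : set M) (f : M -> R) : Prop :=
  forall i, cinfty_on (chart i @` (chart_dom i `&` U)) (f \o chart_inv i).

Definition smooth_on (g : scalars) (U : set M) :
    (M -> scalar_field R g) -> Prop :=
  match g return (M -> scalar_field R g) -> Prop with
  | RealScalars => fun f => smooth_real_on U f
  | ComplexScalars => fun f =>
      smooth_real_on U (fun x => complex.Re (f x)) /\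
      smooth_real_on U (fun x => complex.Im (f x))
  end.

Definition smooth (g : scalars) (f : M -> scalar_field R g) : Prop :=
  smooth_on setT f.

(* A real or complex vector bundle, given by its fibres and a family of local *)
(* trivialisations whose transition matrices are smooth. The rank is allowed  *)
(* to vary from one connected component to another.                           *)
Record vector_bundle (g : scalars) := VectorBundle {
  fibre :> M -> lmodType (scalar_field R g);
  triv_index : Type;
  triv_dom : triv_index -> set M;
  triv_rank : triv_index -> nat;
  triv : forall i x, fibre x -> 'rV[scalar_field R g]_(triv_rank i);
  triv_cover : forall x, exists i, triv_dom i x;
  triv_dom_open : forall i, open (triv_dom i);
  triv_linear : forall i x, triv_dom i x -> linear (@triv i x);
  triv_bijective : forall i x, triv_dom i x -> bijective (@triv i x);
  triv_transition : forall i j,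
    exists T : M -> 'M[scalar_field R g]_(triv_rank i, triv_rank j),
      (forall k l, smooth_on (triv_dom i `&` triv_dom j) (fun x => T x k l)) /\
      (forall x, triv_dom i x -> triv_dom j x ->
        forall v : fibre x, triv j v = triv i v *m T x)
}.

(* Sections are arbitrary families s with s x in the fibre over x;            *)
(* smooth_section selects the elements of Gamma(E). Operators on Gamma(E),    *)
(* such as brackets and connections, are functions on all families, of which  *)
(* only the values on smooth sections are constrained and used.               *)
Definition sect (g : scalars) (E : vector_bundle g) := forall x : M, E x.

Definition smooth_section (g : scalars) (E : vector_bundle g) (s : sect E) :
    Prop :=
  forall (i : triv_index E) k, smooth_on (triv_dom i) (fun x => triv i (s x) 0 k).

(* The fibre of TM (resp. of its complexification) at x: the K-linear point   *)
(* derivations at x of the algebra of smooth K-valued functions, K = R        *)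
(* (resp. K = C).                                                             *)
Definition is_tangent (g : scalars) (x : M)
    (v : (M -> scalar_field R g) -> scalar_field R g) : Prop :=
  (forall c f h, smooth f -> smooth h ->
    v (fun y => c * f y + h y) = c * v f + v h) /\
  (forall f h, smooth f -> smooth h ->
    v (fun y => f y * h y) = v f * h x + f x * v h).

Record lie_algebroid (g : scalars) := LieAlgebroid {
  lie_bundle :> vector_bundle g;
  anchor : forall x, lie_bundle x ->
    (M -> scalar_field R g) -> scalar_field R g;
  bracket : sect lie_bundle -> sect lie_bundle -> sect lie_bundle;
  anchor_tangent : forall x (v : lie_bundle x), is_tangent x (anchor v);
  anchor_linear : forall x c (u v : lie_bundle x) f, smooth f ->
    anchor (c *: u + v) f = c * anchor u f + anchor v f;
  anchor_smooth : forall (l : sect lie_bundle) f, smooth_section l ->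
    smooth f -> smooth (fun x => anchor (l x) f);
  bracket_smooth : forall l m : sect lie_bundle, smooth_section l ->
    smooth_section m -> smooth_section (bracket l m);
  bracket_linear : forall c (l l' m : sect lie_bundle), smooth_section l ->
    smooth_section l' -> smooth_section m ->
    forall x, bracket (fun y => c *: l y + l' y) m x
              = c *: bracket l m x + bracket l' m x;
  bracket_antisym : forall l m : sect lie_bundle, smooth_section l ->
    smooth_section m -> forall x, bracket l m x = - bracket m l x;
  bracket_jacobi : forall l m p : sect lie_bundle, smooth_section l ->
    smooth_section m -> smooth_section p ->
    forall x, bracket l (bracket m p) x + bracket m (bracket p l) x
              + bracket p (bracket l m) x = 0;
  bracket_leibniz : forall f (l m : sect lie_bundle), smooth f ->
    smooth_section l -> smooth_section m ->
    forall x, bracket l (fun y => f y *: m y) x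
              = f x *: bracket l m x + anchor (l x) f *: m x;
  anchor_bracket : forall (l m : sect lie_bundle) f, smooth_section l ->
    smooth_section m -> smooth f ->
    forall x, anchor (bracket l m x) f
              = anchor (l x) (fun y => anchor (m y) f)
                - anchor (m x) (fun y => anchor (l y) f)
}.

(* A Lie subalgebroid over the same base is encoded as a Lie algebroid with   *)
(* an injective morphism over the identity of M: being a fibrewise injective  *)
(* smooth bundle map, incl identifies A with a subbundle of L.                *)
Record lie_pair (g : scalars) := LiePair {
  big : lie_algebroid g;
  sub : lie_algebroid g;
  incl : forall x, sub x -> big x;
  incl_linear : forall x, linear (@incl x);
  incl_injective : forall x, injective (@incl x);
  incl_smooth : forall a : sect sub, smooth_section a ->
    smooth_section ((fun x => incl (a x)) : sect big);
  incl_anchor : forall x (u : sub x) f, smooth f ->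
    anchor (incl u) f = anchor u f;
  incl_bracket : forall a b : sect sub, smooth_section a -> smooth_section b ->
    forall x, incl (bracket a b x)
      = bracket ((fun y => incl (a y)) : sect big) (fun y => incl (b y)) x
}.

Definition is_connection (g : scalars) (L : lie_algebroid g)
    (E : vector_bundle g) (nabla : sect L -> sect E -> sect E) : Prop :=
  [/\ forall l e, smooth_section l -> smooth_section e ->
        smooth_section (nabla l e),
      forall f l l' e, smooth f -> smooth_section l -> smooth_section l' ->
        smooth_section e ->
        forall x, nabla (fun y => f y *: l y + l' y) e x
                  = f x *: nabla l e x + nabla l' e x,
      forall l e e', smooth_section l -> smooth_section e ->
        smooth_section e' ->
        forall x, nabla l (fun y => e y + e' y) x = nabla l e x + nabla l e' x
    & forall f l e, smooth f -> smooth_section l -> smooth_section e ->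
        forall x, nabla l (fun y => f y *: e y) x
                  = f x *: nabla l e x + anchor (l x) f *: e x].

Record lie_module (g : scalars) (A : lie_algebroid g) := LieModule {
  mod_bundle :> vector_bundle g;
  mod_action : sect A -> sect mod_bundle -> sect mod_bundle;
  mod_connection : is_connection mod_action;
  mod_flat : forall a b e, smooth_section a -> smooth_section b ->
    smooth_section e ->
    forall x, mod_action a (mod_action b e) x - mod_action b (mod_action a e) x
              = mod_action (bracket a b) e x
}.

End Smooth.

Section AtiyahClass.
Context {R : realType} {n : nat} {M : smooth_manifold R n} {g : scalars}.
Context (P : lie_pair M g) (E : lie_module (sub P)).

Local Notation L := (big P).
Local Notation A := (sub P).

Definition incl_sect (a : sect A) : sect L := fun x => incl (a x).

Definition extends_action (nabla : sect L -> sect E -> sect E) : Prop :=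
  forall a e, smooth_section a -> smooth_section e ->
    forall x, nabla (incl_sect a) e x = mod_action a e x.

Definition A_compatible (nabla : sect L -> sect E -> sect E) : Prop :=
  extends_action nabla /\
  (forall a l e, smooth_section a -> smooth_section l -> smooth_section e ->
    forall x, nabla (incl_sect a) (nabla l e) x
              - nabla l (nabla (incl_sect a) e) x
              = nabla (bracket (incl_sect a) l) e x).

(* The fibre at x of Aperp (x) End E, Aperp being the annihilator of A in     *)
(* L^*: the bilinear maps t : L_x x E_x -> E_x that vanish on A_x. Such a t   *)
(* has a value t(q(v)) on the class q(v) in L_x/A_x, namely t v.              *)
Definition in_perp_End (x : M) (t : L x -> E x -> E x) : Prop :=
  [/\ forall w, linear (fun v => t v w),
      forall v, linear (t v)
    & forall u w, t (incl u) w = 0].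

(* Elements of Gamma(Aperp (x) End E). *)
Definition is_0cochain (phi : forall x, L x -> E x -> E x) : Prop :=
  (forall x, in_perp_End (phi x)) /\
  (forall l e, smooth_section l -> smooth_section e ->
    smooth_section ((fun x => phi x (l x) (e x)) : sect E)).

(* Elements of Gamma(A^* (x) Aperp (x) End E). *)
Definition is_1cochain (omega : forall x, A x -> L x -> E x -> E x) : Prop :=
  [/\ forall x v w, linear (fun u => omega x u v w),
      forall x u, in_perp_End (omega x u)
    & forall a l e, smooth_section a -> smooth_section l -> smooth_section e ->
        smooth_section ((fun x => omega x (a x) (l x) (e x)) : sect E)].

Definition eval0 (phi : forall x, L x -> E x -> E x)
    (l : sect L) (e : sect E) : sect E := fun x => phi x (l x) (e x).

Definition contract (omega : forall x, A x -> L x -> E x -> E x) (a : sect A) :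
    forall x, L x -> E x -> E x := fun x => omega x (a x).

(* The A-module structure on Aperp (x) End E:                                 *)
(*   (a . phi)(l) = [nabla_a, phi(l)] - phi([a, l]),                          *)
(* which combines the commutator action on End E with the dual of the action  *)
(* nabla_a (q l) = q [a, l] on L/A.                                           *)
Definition perp_End_action (a : sect A) (phi : forall x, L x -> E x -> E x)
    (l : sect L) (e : sect E) : sect E := fun x =>
  mod_action a (eval0 phi l e) x - eval0 phi l (mod_action a e) x
  - eval0 phi (bracket (incl_sect a) l) e x.

(* Chevalley-Eilenberg differentials of A with values in Aperp (x) End E in   *)
(* degrees 0 and 1, evaluated on sections of A, L and E.                      *)
Definition d0 (phi : forall x, L x -> E x -> E x) (a : sect A)
    (l : sect L) (e : sect E) : sect E :=
  perp_End_action a phi l e.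

Definition d1 (omega : forall x, A x -> L x -> E x -> E x) (a b : sect A)
    (l : sect L) (e : sect E) : sect E := fun x =>
  perp_End_action a (contract omega b) l e x
  - perp_End_action b (contract omega a) l e x
  - eval0 (contract omega (bracket a b)) l e x.

Definition is_1cocycle (omega : forall x, A x -> L x -> E x -> E x) : Prop :=
  is_1cochain omega /\
  (forall a b l e, smooth_section a -> smooth_section b -> smooth_section l ->
    smooth_section e -> forall x, d1 omega a b l e x = 0).

Definition cohomologous (omega omega' : forall x, A x -> L x -> E x -> E x) :
    Prop :=
  exists2 phi, is_0cochain phi &
    forall a l e, smooth_section a -> smooth_section l -> smooth_section e ->
      forall x, omega x (a x) (l x) (e x) - omega' x (a x) (l x) (e x)
                = d0 phi a l e x.

(* A class in H^1(A, Aperp (x) End E) is a coset of the coboundaries in the   *)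
(* space of 1-cocycles.                                                       *)
Definition cohomology_class (omega : forall x, A x -> L x -> E x -> E x) :
    set (forall x, A x -> L x -> E x -> E x) :=
  [set omega' | is_1cocycle omega' /\ cohomologous omega' omega].

Definition zero_cochain : forall x, A x -> L x -> E x -> E x :=
  fun x _ _ _ => 0.

(* rho is the section R^nabla of A^* (x) Aperp (x) End E defined by nabla. *)
Definition is_atiyah_cochain (nabla : sect L -> sect E -> sect E)
    (rho : forall x, A x -> L x -> E x -> E x) : Prop :=
  is_1cochain rho /\
  (forall a l e, smooth_section a -> smooth_section l -> smooth_section e ->
    forall x, rho x (a x) (l x) (e x)
              = nabla (incl_sect a) (nabla l e) x
                - nabla l (nabla (incl_sect a) e) x
                - nabla (bracket (incl_sect a) l) e x).

End AtiyahClass.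

(* Main.v *)
Require Import Defs.
From mathcomp Require Import all_boot all_order all_algebra complex.
From mathcomp Require Import all_classical all_reals all_analysis.
From mathcomp Require Import ring lra.
Import Order.TTheory GRing.Theory Num.Theory.
Import numFieldNormedType.Exports.
Set Implicit Arguments.
Unset Strict Implicit.
Unset Printing Implicit Defensive.
Local Open Scope classical_set_scope.
Local Open Scope ring_scope.

(** The proof has an algebraic half and an analytic half.

    Algebra. For an L-connection nabla extending the action, the Atiyah cochain
    is the restriction to A x L of the curvature
    [nabla_l, nabla_m] - nabla_[l, m] of nabla. The curvature vanishes on A x A
    because E is flat over A, so the cochain takes values in the annihilator of
    A. Expanding d R(a, b; l) into composites of covariant derivatives, all
    terms cancel by flatness of the action and the Jacobi identity of L; this
    is the Bianchi identity with two arguments in A (atiyah_cochain_cocycle).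
    Two connections that extend the action differ by a section phi of
    Aperp (x) End E (connection_difference), and the difference of their
    Atiyah cochains is exactly d phi (d0_connection_difference): this gives
    the independence of the class. If the class vanishes, R = d phi, then
    nabla - phi is again a connection extending the action
    (connection_translate), and its Atiyah cochain R - d phi is 0, which is
    A-compatibility. Conversely the Atiyah cochain of an A-compatible
    connection is 0.

    Analysis. Brackets and connections are operators on global sections, while
    cochains are families of multilinear maps on the fibres. The passage from
    the former to the latter is the tensoriality lemma (tensorial_at_eq): an
    operator T on smooth sections with T (f s + t) = f x * T s + T t depends on
    the value of the section at x only. Choose a smooth function chi with
    chi x = 1, supported in the domain of a trivialisation. The functions
    chi * s^k, with s^k the components of s, and the sections chi * e_k, with
    e_k the local frame, are all globally smooth after extension by 0, and
    chi^2 s is the sum of the (chi s^k) (chi e_k). Hence T s is the sum of the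
    s^k(x) T (chi e_k). The same frames provide a smooth section through every
    vector (section_through), so tensorial operators and fibrewise linear maps
    determine each other. The function chi is built in a chart out of
    exp (- 1 / t); its support is compact, hence closed in M as M is Hausdorff
    (bump_function). *)

(** * Smooth functions on open subsets of R^n *)

(** The difference g - f vanishes near x, so its differential at x is 0. *)
Lemma near_eq_differentiable (R : numFieldType) (V W : normedModType R)
    (f g : V -> W) (x : V) :
  (\forall y \near x, f y = g y) -> differentiable f x -> differentiable g x.
Proof.
move=> fg df.
have hx0 : (g - f) x = 0.
  by rewrite -[LHS]/(g x - f x) (nbhs_singleton fg) subrr.
have h0 : (g - f) \o shift x = cst ((g - f) x) + (\0 : V -> W) +o_ 0 id.
  apply/eqaddoP => e e0; rewrite hx0.
  have : \forall y \near (0 : V), f (shift x y) = g (shift x y).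
    have := fg; rewrite [X in X -> _](near_shift 0).
    by apply: filterS => y; rewrite /= subr0.
  apply: filterS => y /= e1; rewrite !fctE /= e1 subrr sub0r addr0 oppr0 normr0.
  by rewrite mulr_ge0 // ltW.
have dh0 : differentiable (g - f) x.
  apply/diff_locallyP; 
  rewrite (@diff_unique _ _ _ _ (\0 : V -> W) x _ h0).
    by split; first exact: cst_continuous.
  exact: cst_continuous.
have -> : g = f + (g - f) by rewrite addrC subrK.
exact: differentiableD.
Qed.

(** Smoothness on W is a greatest fixpoint: partial derivatives of a member of S
    never leave S, up to equality on the open set W. This trades the induction
    on the order of differentiation for a single check that S is closed under
    first partial derivatives. *)
Lemma cinfty_coind (R : realType) (n : nat) (W : set 'rV[R]_n)
    (S : set ('rV[R]_n -> R)) : open W ->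
  (forall f, S f -> (forall y, W y -> differentiable f y) /\
     forall i, exists2 h, S h & forall y, W y -> 'D_(delta_mx 0 i) f y = h y) ->
  forall f h, S h -> (forall y, W y -> f y = h y) -> cinfty_on W f.
Proof.
move=> Wo SP f h Sh fh s.
have near_W u v : (forall y, W y -> u y = v y) ->
    forall y, W y -> \forall z \near y, u z = v z.
  move=> uv y Wy; have := open_nbhs_nbhs (conj Wo Wy).
  by apply: filterS => z; apply: uv.
suff [k Sk ek] : exists2 k, S k &
    forall y, W y -> iterated_partial s f y = k y.
  move=> y Wy; have [dk _] := SP _ Sk.
  apply: near_eq_differentiable (dk _ Wy).
  by apply: near_W Wy => z Wz; rewrite ek.
elim: s => [|i s [k Sk ek]] /=; first by exists h.
have [_ /(_ i)[k' Sk' ek']] := SP _ Sk; exists k' => // y Wy.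
by rewrite -ek' //; apply/near_eq_derive/near_W.
Qed.

(** * The flat exponential and closure properties of smoothness *)

(** The factor x^-k is there to make the family closed under differentiation:
    the derivative of the k-th function is a combination of the functions of
    index k + 1 and k + 2, so all of them are smooth at once. *)
Definition flat_exp (R : realType) (k : nat) (x : R) : R :=
  if 0 < x then x^-1 ^+ k * expR (- x^-1) else 0.

(** Apply exp t >= t^(k+2) / (k+2)! to t = 1 / x. The linear bound for the index
    k + 1 is what makes the difference quotient of the k-th function at 0 tend
    to 0. *)
Lemma flat_exp_le (R : realType) (k : nat) (x : R) : 0 < x ->
  flat_exp k.+1 x <= (k.+2)`!%:R * x.
Proof.
move=> x0; rewrite /flat_exp x0 expRN ler_pdivrMr ?expR_gt0 //.
have fpos : 0 < (k.+2)`!%:R :> R by rewrite ltr0n fact_gt0.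
have /(_ (ltW _)) := @expR_ge1Dxn R x^-1 k.+1.
rewrite invr_gt0 => /(_ x0) h.
have {}h : x^-1 ^+ k.+2 / (k.+2)`!%:R <= expR x^-1 by lra.
have -> : x^-1 ^+ k.+1 = (k.+2)`!%:R * x * (x^-1 ^+ k.+2 / (k.+2)`!%:R).
  by rewrite [x^-1 ^+ k.+2]exprS; field; rewrite gt_eqF ?fpos //= gt_eqF.
by rewrite ler_wpM2l // mulr_ge0 // ltW.
Qed.

Lemma is_derive_flat_exp (R : realType) (k : nat) (x : R) :
  is_derive x 1 (flat_exp k) (flat_exp k.+2 x - k%:R * flat_exp k.+1 x).
Proof.
have [x0|x0|x0] := ltgtP 0 x; last rewrite -x0.
- pose f (y : R) := y^-1 ^+ k * expR (- y^-1).
  apply: (@near_eq_is_derive _ _ _ f).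
    near=> y; rewrite /flat_exp ifT //; near: y; exact: lt_nbhsr.
  have xn0 : x != 0 by rewrite gt_eqF.
  have dinv : is_derive x 1 (fun y : R => y^-1) (- x ^- 2).
    apply: is_derive_eq; first exact: (@is_deriveV _ id x 1 1 xn0).
    by rewrite /= scaler1.
  have dexp : is_derive x 1 (fun y : R => expR (- y^-1))
      (expR (- x^-1) * x ^- 2).
    apply: (@is_derive1_comp _ expR (fun y => - y^-1)).
    by rewrite -[x ^- 2]opprK; exact: (is_deriveN dinv).
  have -> : f = (fun y : R => y^-1) ^+ k * (fun y : R => expR (- y^-1)).
    by apply/funext => y; rewrite /f [in RHS]fctE exprfctE.
  apply: (is_derive_eq (is_deriveM (is_deriveX k dinv) dexp)).
  rewrite /flat_exp x0 exprfctE /= !exprS /GRing.scale /=.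
  by case: (k) => [|j] /=; rewrite ?exprS; field.
- apply: (@near_eq_is_derive _ _ _ (cst 0)).
    near=> y; rewrite /flat_exp ifF //; apply/negbTE; rewrite -leNgt.
    by apply: ltW; near: y; exact: lt_nbhsl.
  by rewrite /flat_exp ltNge (ltW x0) /= mulr0 subr0; exact: is_derive_cst.
- have -> : flat_exp k.+2 0 - k%:R * flat_exp k.+1 0 = 0 :> R.
    by rewrite /flat_exp ltxx mulr0 subr0.
  have h : (fun h : R =>
      h^-1 *: ((flat_exp k \o shift 0) (h *: 1) - flat_exp k 0)) @ 0^'
      --> (0 : R).
    apply: (@cvg_to_0_linear _ _ (k.+2)`!%:R 1 ltr01) => h /andP[h0 _].
    rewrite /= addr0 scaler1 [flat_exp k 0]/flat_exp ltxx subr0 /flat_exp.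
    have [hpos|_] := ltP 0 h; last by rewrite scaler0 normr0 mulr_ge0.
    have := flat_exp_le k hpos; rewrite /flat_exp hpos exprS -mulrA => le_h.
    have hge0 : 0 <= h^-1 * (h^-1 ^+ k * expR (- h^-1)).
      by rewrite !mulr_ge0 ?exprn_ge0 ?expR_ge0 ?invr_ge0 // ltW.
    by rewrite [_ *: _]/(_ * _) ger0_norm // gtr0_norm.
  apply: DeriveDef.
    by apply/cvg_ex; exists 0.
  exact/cvg_lim.
Unshelve. all: by end_near. Qed.

Lemma differentiable_flat_exp (R : realType) (k : nat) (x : R) :
  differentiable (flat_exp k) x.
Proof. by apply/derivable1_diffP; have [] := is_derive_flat_exp k x. Qed.

Lemma cinfty_on_partial (R : realType) (n : nat) (W : set 'rV[R]_n)
    (f : 'rV[R]_n -> R) (i : 'I_n) :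
  cinfty_on W f -> cinfty_on W ('D_(delta_mx 0 i) f).
Proof.
move=> Wf s y Wy; have := Wf (rcons s i) y Wy.
by rewrite /iterated_partial foldr_rcons.
Qed.

(** The family to which the coinduction is applied. Closing it under all the
    operations simultaneously gives the stability of smoothness under each of
    them, because the product and chain rules stay inside the family. *)
Inductive smooth_expr (R : realType) (n : nat) (W : set 'rV[R]_n) :
    ('rV[R]_n -> R) -> Prop :=
| SmoothAtom f : cinfty_on W f -> smooth_expr W f
| SmoothCst c : smooth_expr W (cst c)
| SmoothAdd f h : smooth_expr W f -> smooth_expr W h -> smooth_expr W (f + h)
| SmoothMul f h : smooth_expr W f -> smooth_expr W h -> smooth_expr W (f * h)
| SmoothFlat k f : smooth_expr W f -> smooth_expr W (flat_exp k \o f).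

Lemma cinfty_on_expr (R : realType) (n : nat) (W : set 'rV[R]_n)
    (f h : 'rV[R]_n -> R) : open W ->
  smooth_expr W h -> (forall y, W y -> f y = h y) -> cinfty_on W f.
Proof.
move=> Wo; apply: (cinfty_coind (S := smooth_expr W) Wo).
move=> {f}{}h; elim=> {h} [f Wf|c|f h _ [df Df] _ [dh Dh]
  |f h Sf [df Df] Sh [dh Dh]|k f Sf [df Df]].
- split; first exact: (Wf [::]).
  move=> i; exists ('D_(delta_mx 0 i) f) => //.
  by apply: SmoothAtom; exact: cinfty_on_partial.
- split=> [y _|i]; first exact: differentiable_cst.
  by exists (cst 0); [exact: SmoothCst | move=> y _; rewrite derive_cst].
- split=> [y Wy|i]; first by apply: differentiableD; auto.
  have [[f' Sf' ef] [h' Sh' eh]] := (Df i, Dh i).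
  exists (f' + h'); first exact: SmoothAdd.
  by move=> y Wy; rewrite deriveD ?ef ?eh //; apply: diff_derivable; auto.
- split=> [y Wy|i]; first by apply: differentiableM; auto.
  have [[f' Sf' ef] [h' Sh' eh]] := (Df i, Dh i).
  exists (f * h' + h * f'); first by apply: SmoothAdd; apply: SmoothMul.
  by move=> y Wy; rewrite deriveM ?ef ?eh //; apply: diff_derivable; auto.
- have dk y : differentiable (flat_exp k) y by exact: differentiable_flat_exp.
  split=> [y Wy|i]; first by apply: differentiable_comp; auto.
  have [f' Sf' ef] := Df i.
  exists ((flat_exp k.+2 \o f + cst (- k%:R) * (flat_exp k.+1 \o f)) * f').
    apply: SmoothMul => //; apply: SmoothAdd; first exact: SmoothFlat.
    by apply: SmoothMul; [exact: SmoothCst | exact: SmoothFlat].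
  move=> y Wy; rewrite deriveE; last by apply: differentiable_comp; auto.
  rewrite diff_comp; [|by auto|by auto].
  rewrite /= -(deriveE _ (df y Wy)) ef // diff1E // derive1E.
  have [_ ->] := is_derive_flat_exp k (f y).
  by rewrite [LHS]mulrC mulNr.
Qed.

(** * Real-valued smooth functions on a manifold and bump functions *)

Section RealSmooth.
Context {R : realType} {n : nat} (M : smooth_manifold R n).
Implicit Types (U V : set M) (f h : M -> R).

Lemma chart_img_open_in (i : chart_index M) U : open U ->
  open (chart i @` (chart_dom i `&` U)).
Proof.
move=> Uo; rewrite openE => _ [x [ix Ux] <-].
have iy : (chart i @` chart_dom i) (chart i x) by exists x.
have near_img := open_nbhs_nbhs (conj (chart_img_open (i := i)) iy).
have Wx : nbhs (chart_inv i (chart i x)) U.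
  by rewrite chartK //; exact: open_nbhs_nbhs.
have near_inv := chart_inv_continuous iy Wx.
rewrite /interior /=; near=> z.
have [p ip pz] : (chart i @` chart_dom i) z by near: z.
exists p => //; split=> //; rewrite -(chartK ip) pz.
by near: z.
Unshelve. all: by end_near. Qed.

Lemma smooth_real_on_sub U V f : V `<=` U ->
  smooth_real_on U f -> smooth_real_on V f.
Proof.
move=> VU Uf i s _ [x [ix Vx] <-].
by apply: Uf; exists x => //; split => //; exact: VU.
Qed.

(** Smooth functions on U are those that are given in each chart by a smooth
    expression; stability under algebraic operations is the main instance. *)
Lemma smooth_real_on_expr U f (h : chart_index M -> 'rV[R]_n -> R) : open U ->
  (forall i, smooth_expr (chart i @` (chart_dom i `&` U)) (h i)) ->
  (forall i x, chart_dom i x -> U x -> f x = h i (chart i x)) ->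
  smooth_real_on U f.
Proof.
move=> Uo Sh fh i; apply: (cinfty_on_expr (chart_img_open_in Uo) (Sh i)).
by move=> _ [x [ix Ux] <-] /=; rewrite chartK //; exact: fh.
Qed.

Lemma smooth_real_on_eq U f h : open U -> (forall x, U x -> f x = h x) ->
  smooth_real_on U h -> smooth_real_on U f.
Proof.
move=> Uo fh Uh; apply: (smooth_real_on_expr (h := fun i => h \o chart_inv i) Uo
  (fun i => SmoothAtom (Uh i))).
by move=> i x ix Ux /=; rewrite chartK //; exact: fh.
Qed.

Lemma smooth_real_on_local U f :
  (forall x, U x -> exists V, [/\ open V, V x & smooth_real_on V f]) ->
  smooth_real_on U f.
Proof.
move=> loc i s _ [x [ix Ux] <-]; have [V [_ Vx Vf]] := loc x Ux.
by apply: Vf; exists x.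
Qed.

Lemma smooth_real_on_cst U c : open U -> smooth_real_on U (cst c).
Proof.
by move=> Uo; apply: (@smooth_real_on_expr _ _ (fun=> cst c)) => // i;
  exact: SmoothCst.
Qed.

Lemma smooth_real_onD U f h : open U ->
  smooth_real_on U f -> smooth_real_on U h ->
  smooth_real_on U (fun x => f x + h x).
Proof.
move=> Uo Uf Uh; apply: (smooth_real_on_expr
  (h := fun i => (f \o chart_inv i) + (h \o chart_inv i)) Uo
  (fun i => SmoothAdd (SmoothAtom (Uf i)) (SmoothAtom (Uh i)))).
by move=> i x ix _; rewrite fctE /= chartK.
Qed.

Lemma smooth_real_onM U f h : open U ->
  smooth_real_on U f -> smooth_real_on U h ->
  smooth_real_on U (fun x => f x * h x).
Proof.
move=> Uo Uf Uh; apply: (smooth_real_on_expr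
  (h := fun i => (f \o chart_inv i) * (h \o chart_inv i)) Uo
  (fun i => SmoothMul (SmoothAtom (Uf i)) (SmoothAtom (Uh i)))).
by move=> i x ix _; rewrite fctE /= chartK.
Qed.

Lemma smooth_real_on_flat U k f : open U ->
  smooth_real_on U f -> smooth_real_on U (fun x => flat_exp k (f x)).
Proof.
move=> Uo Uf; apply: (smooth_real_on_expr
  (h := fun i => flat_exp k \o (f \o chart_inv i)) Uo
  (fun i => SmoothFlat k (SmoothAtom (Uf i)))).
by move=> i x ix _; rewrite /= chartK.
Qed.

Lemma smooth_real_onN U f : open U ->
  smooth_real_on U f -> smooth_real_on U (fun x => - f x).
Proof.
move=> Uo Uf; apply: (@smooth_real_on_eq _ _ (fun x => -1 * f x)) => //.
  by move=> x _; rewrite mulN1r.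
by apply: smooth_real_onM => //; exact: smooth_real_on_cst.
Qed.

Lemma smooth_real_on_sum U (I : Type) (r : seq I) (F : I -> M -> R) :
  open U -> (forall k, smooth_real_on U (F k)) ->
  smooth_real_on U (fun x => \sum_(k <- r) F k x).
Proof.
move=> Uo UF; elim: r => [|k r IHr].
  apply: (@smooth_real_on_eq _ _ (cst 0)) => //.
    by move=> x _; rewrite big_nil.
  exact: smooth_real_on_cst.
apply: (@smooth_real_on_eq _ _ (fun x => F k x + \sum_(j <- r) F j x)) => //.
  by move=> x _; rewrite big_cons.
exact: smooth_real_onD.
Qed.

Lemma smooth_real_on_coord (c : chart_index M) (k : 'I_n) :
  smooth_real_on (chart_dom c) (fun x => chart c x 0 k).
Proof. by move=> i; exact: chart_transition. Qed.

(** In a chart c around x, take flat_exp 0 (r^2 - q) where q is the squared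
    Euclidean distance to c x. It vanishes outside the cube of half-side r; for
    r small the cube lies in the image of U, and the part C of M that
    corresponds to it is compact, hence closed. *)
Lemma bump_function (x : M) U : open U -> U x ->
  exists chi : M -> R, [/\ smooth_real_on setT chi, chi x = 1 &
    exists C, [/\ closed C, C `<=` U & forall y, ~ C y -> chi y = 0]].
Proof.
move=> Uo Ux; have [c cx] := chart_cover x.
have Wo := chart_img_open_in (i := c) Uo.
have Wx : (chart c @` (chart_dom c `&` U)) (chart c x) by exists x.
have /nbhs_ballP[e /= e0 eW] := open_nbhs_nbhs (conj Wo Wx).
pose r := e / 2; have r0 : 0 < r by rewrite divr_gt0.
pose cube := [set v : 'rV[R]_n | forall k : 'I_n,
  `[chart c x 0 k - r, chart c x 0 k + r]%classic (v ord0 k)].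
have cubeW : cube `<=` chart c @` (chart_dom c `&` U).
  move=> v vr; apply: eW; split=> // i k; have := vr k.
  rewrite (ord1 i) /= in_itv /= -ler_distl distrC => vr_k.
  apply: le_lt_trans vr_k _.
  by rewrite /r ltr_pdivrMr // ltr_pMr // ltr1n.
have cube_compact : compact cube.
  exact: (rV_compact (fun k : 'I_n => @segment_compact R _ _)).
pose C := chart_inv c @` cube.
have CU : C `<=` chart_dom c `&` U.
  by move=> _ [v /cubeW [p [cp Up] <-] <-]; rewrite chartK.
have C_closed : closed C.
  apply: compact_closed; first exact: man_hausdorff.
  apply: continuous_compact => //; apply: continuous_in_subspaceT => v.
  rewrite inE => /cubeW [p [cp _] <-].
  by apply: chart_inv_continuous; exists p.
pose q p := \sum_(k <- index_enum 'I_n) (chart c p 0 k - chart c x 0 k) ^+ 2.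
have qx : q x = 0 by rewrite /q big1 // => k _; rewrite subrr expr0n.
pose a := flat_exp 0 (r ^+ 2).
have a0 : a != 0.
  by rewrite /a /flat_exp exprn_gt0 // expr0 mul1r gt_eqF // expR_gt0.
pose b p := a^-1 * flat_exp 0 (r ^+ 2 - q p).
pose chi p := if `[< chart_dom c p >] then b p else 0.
have chi0 p : ~ C p -> chi p = 0.
  move=> nCp; rewrite /chi; case: asboolP => // cp.
  rewrite /b /flat_exp; case: ifPn => [|_]; last by rewrite mulr0.
  rewrite subr_gt0 => qr; case: nCp; exists (chart c p); last exact: chartK.
  move=> k; rewrite /= in_itv /= -ler_distl.
  have : (chart c p 0 k - chart c x 0 k) ^+ 2 <= r ^+ 2.
    apply: le_trans (ltW qr); rewrite /q (bigD1 k) //= lerDl.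
    by apply: sumr_ge0 => j _; exact: sqr_ge0.
  by rewrite -ler_sqrt ?sqr_ge0 // !sqrtr_sqr (gtr0_norm r0).
exists chi; split.
- apply: smooth_real_on_local => p _.
  have [cp|ncp] := pselect (chart_dom c p).
    exists (chart_dom c); split => //; first exact: chart_dom_open.
    have co : open (chart_dom c) by exact: chart_dom_open.
    apply: (smooth_real_on_eq co (h := b)).
      by move=> z cz; rewrite /chi asboolT.
    apply: smooth_real_onM => //; first exact: smooth_real_on_cst.
    apply: smooth_real_on_flat => //.
    apply: smooth_real_onD => //; first exact: smooth_real_on_cst.
    apply: smooth_real_onN => //; apply: smooth_real_on_sum => // k.
    have coordB : smooth_real_on (chart_dom c)
        (fun z => chart c z 0 k - chart c x 0 k).
      apply: smooth_real_onD => //; first exact: smooth_real_on_coord.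
      exact: smooth_real_on_cst.
    exact: smooth_real_onM.
  have Co : open (~` C) by exact: closed_openC.
  exists (~` C); split => //; first by move=> /CU[].
  apply: (smooth_real_on_eq Co (h := cst 0)); first exact: chi0.
  exact: smooth_real_on_cst.
- by rewrite /chi asboolT // /b qx subr0 mulVf.
- by exists C; split=> // y /CU[].
Qed.
End RealSmooth.

(** * Smooth functions with real or complex values *)

Section ScalarSmooth.
Context {R : realType} {n : nat} (M : smooth_manifold R n) (g : scalars).
Local Notation K := (scalar_field R g).
Implicit Types (U V : set M) (f h : M -> K).

Lemma smooth_on_sub U V f : V `<=` U -> smooth_on U f -> smooth_on V f.
Proof.
case: g f => f VU /=; first exact: smooth_real_on_sub.
by case=> fr fi; split; apply: smooth_real_on_sub VU _.
Qed.

Lemma smooth_on_eq U f h : open U -> (forall x, U x -> f x = h x) ->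
  smooth_on U h -> smooth_on U f.
Proof.
case: g f h => f h Uo fh /=; first exact: smooth_real_on_eq.
by case=> hr hi; split;
  [apply: smooth_real_on_eq hr | apply: smooth_real_on_eq hi] => // x Ux;
  rewrite fh.
Qed.

Lemma smooth_on_local U f :
  (forall x, U x -> exists V, [/\ open V, V x & smooth_on V f]) ->
  smooth_on U f.
Proof.
case: g f => f /= loc; first exact: smooth_real_on_local.
split; apply: smooth_real_on_local => x /loc[V [Vo Vx []]]; by exists V.
Qed.

Lemma smooth_on_cst U (c : K) : open U -> smooth_on U (fun=> c).
Proof.
case: g c => c Uo /=; first exact: smooth_real_on_cst.
by split; exact: smooth_real_on_cst.
Qed.

Lemma smooth_cst (c : K) : smooth ((fun=> c) : M -> K).
Proof. exact: (smooth_on_cst c openT). Qed.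

Lemma smooth_onD U f h : open U ->
  smooth_on U f -> smooth_on U h -> smooth_on U (fun x => f x + h x).
Proof.
case: g f h => f h Uo /=; first exact: smooth_real_onD.
move=> [fr fi] [hr hi]; split.
  apply: smooth_real_on_eq (smooth_real_onD Uo fr hr) => // x _.
  by case: (f x) (h x) => a b [].
apply: smooth_real_on_eq (smooth_real_onD Uo fi hi) => // x _.
by case: (f x) (h x) => a b [].
Qed.

Lemma smooth_onM U f h : open U ->
  smooth_on U f -> smooth_on U h -> smooth_on U (fun x => f x * h x).
Proof.
case: g f h => f h Uo /=; first exact: smooth_real_onM.
move=> [fr fi] [hr hi]; split.
  apply: smooth_real_on_eq (smooth_real_onD Uo (smooth_real_onM Uo fr hr)
    (smooth_real_onN Uo (smooth_real_onM Uo fi hi))) => // x _.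
  by case: (f x) (h x) => a b [].
apply: smooth_real_on_eq (smooth_real_onD Uo (smooth_real_onM Uo fr hi)
    (smooth_real_onM Uo fi hr)) => // x _.
by case: (f x) (h x) => a b [].
Qed.

Lemma smooth_onN U f : open U ->
  smooth_on U f -> smooth_on U (fun x => - f x).
Proof.
move=> Uo Uf; have Um1 := smooth_on_cst (-1) Uo.
apply: smooth_on_eq (smooth_onM Uo Um1 Uf) => //.
by move=> x _; rewrite mulN1r.
Qed.

Lemma bump_scalar (x : M) U : open U -> U x ->
  exists chi : M -> K, [/\ smooth chi, chi x = 1 &
    exists C, [/\ closed C, C `<=` U & forall y, ~ C y -> chi y = 0]].
Proof.
move=> Uo Ux; have [b [bs bx [C [Cc CU bC]]]] := bump_function Uo Ux.
case: (g) => /=; first by exists b; split=> //; exists C.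
exists (fun y => (b y)%:C%C); split; last 1 first.
- by exists C; split=> // y /bC /= ->.
- split=> //=; exact: (smooth_real_on_cst 0 openT).
- by rewrite bx.
Qed.

(** Extension by 0 preserves smoothness here because U and the complement of C
    are open and cover M. *)
Lemma smooth_onT_support U C f : open U -> closed C -> C `<=` U ->
  (forall y, ~ C y -> f y = 0) -> smooth_on U f -> smooth f.
Proof.
move=> Uo Cc CU f0 Uf; apply: smooth_on_local => x _.
have [Ux|nUx] := pselect (U x); first by exists U.
have Co : open (~` C) by exact: closed_openC.
exists (~` C); split=> //; first by move=> /CU.
by apply: smooth_on_eq (smooth_on_cst 0 Co) => // y /f0.
Qed.

End ScalarSmooth.

Arguments smooth_cst {R n M g} c.

(** * Smooth sections and tensoriality *)

Section Sections.
Context {R : realType} {n : nat} {M : smooth_manifold R n} {g : scalars}.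
Local Notation K := (scalar_field R g).
Context (E : vector_bundle M g).
Implicit Types (s t : sect E) (f : M -> K).

Lemma eq_sect s t : (forall x, s x = t x) -> s = t.
Proof. exact: functional_extensionality_dep. Qed.

Lemma triv0 (i : triv_index E) x : triv_dom i x -> triv i (0 : E x) = 0.
Proof.
move=> ix; have := triv_linear ix (-1) 0 0.
by rewrite scaler0 addr0 scaleN1r addNr.
Qed.

Lemma trivZ (i : triv_index E) x c (v : E x) : triv_dom i x ->
  triv i (c *: v) = c *: triv i v.
Proof.
by move=> ix; rewrite -[c *: v]addr0 (triv_linear ix) triv0 // addr0.
Qed.

Lemma triv_sum (i : triv_index E) x (I : Type) (r : seq I) (F : I -> E x) :
  triv_dom i x -> triv i (\sum_(k <- r) F k) = \sum_(k <- r) triv i (F k).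
Proof.
move=> ix; elim: r => [|k r IHr]; first by rewrite !big_nil triv0.
by rewrite !big_cons -[F k]scale1r (triv_linear ix) IHr !scale1r.
Qed.

Lemma smooth_sectionDZ f s t : smooth f -> smooth_section s ->
  smooth_section t -> smooth_section ((fun x => f x *: s x + t x) : sect E).
Proof.
move=> fs ss ts i k; have Uo := triv_dom_open (i : triv_index E).
have fi : smooth_on (triv_dom i) f by apply: smooth_on_sub fs => x _.
apply: smooth_on_eq (smooth_onD Uo (smooth_onM Uo fi (ss i k)) (ts i k)) => //.
by move=> x ix; rewrite (triv_linear ix) !mxE.
Qed.

Lemma smooth_section0 : smooth_section ((fun x => 0) : sect E).
Proof.
move=> i k; have Uo := triv_dom_open (i : triv_index E).
apply: smooth_on_eq (smooth_on_cst 0 Uo) => // x ix.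
by rewrite triv0 // mxE.
Qed.

Lemma smooth_sectionZ f s : smooth f -> smooth_section s ->
  smooth_section ((fun x => f x *: s x) : sect E).
Proof.
move=> fs ss; have := smooth_sectionDZ fs ss smooth_section0.
by congr smooth_section; apply: eq_sect => x; rewrite addr0.
Qed.

Lemma smooth_sectionD s t : smooth_section s -> smooth_section t ->
  smooth_section ((fun x => s x + t x) : sect E).
Proof.
move=> ss ts; have := smooth_sectionDZ (smooth_cst 1) ss ts.
by congr smooth_section; apply: eq_sect => x; rewrite scale1r.
Qed.

Lemma smooth_sectionN s : smooth_section s ->
  smooth_section ((fun x => - s x) : sect E).
Proof.
move=> ss; have := smooth_sectionZ (smooth_cst (-1)) ss.
by congr smooth_section; apply: eq_sect => x; rewrite scaleN1r.
Qed.

Lemma smooth_sectionB s t : smooth_section s -> smooth_section t ->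
  smooth_section ((fun x => s x - t x) : sect E).
Proof. by move=> ss ts; exact/smooth_sectionD/smooth_sectionN. Qed.

Lemma smooth_section_sum (I : Type) (r : seq I) (F : I -> sect E) :
  (forall k, smooth_section (F k)) ->
  smooth_section ((fun x => \sum_(k <- r) F k x) : sect E).
Proof.
move=> Fs; elim: r => [|k r IHr].
  have := smooth_section0.
  by congr smooth_section; apply: eq_sect => x; rewrite big_nil.
have := smooth_sectionD (Fs k) IHr.
by congr smooth_section; apply: eq_sect => x; rewrite big_cons.
Qed.

(** A local frame and its coordinate functions, both multiplied by a cutoff chi
    to make them global; this is why chi appears squared in the last equation.
    The coordinates co k s at a point depend on the value of s there only, and the
    equation holds for all families s, so that it also applies to a family that
    is prescribed at one point. *)
Lemma bump_frame (x : M) : exists (r : nat) (chi : M -> K)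
    (co : 'I_r -> sect E -> M -> K) (fr : 'I_r -> sect E),
  [/\ smooth chi, chi x = 1,
      forall k, smooth_section (fr k),
      forall k s, smooth_section s -> smooth (co k s) &
      (forall k s t, s x = t x -> co k s x = co k t x) /\
      forall s y, \sum_k co k s y *: fr k y = (chi y * chi y) *: s y].
Proof.
have [i ix] := triv_cover E x; have Uo := triv_dom_open (i : triv_index E).
have [chi [chis chix [C [Cc CU chi0]]]] := bump_scalar g Uo ix.
have inv_ex y : exists h : 'rV[K]_(triv_rank i) -> E y,
    triv_dom i y -> cancel (triv i (x := y)) h /\ cancel h (triv i (x := y)).
  have [iy|niy] := pselect (triv_dom i y); last by exists (fun=> 0).
  by have [h hK Kh] := triv_bijective iy; exists h.
have [inv invK] : exists inv : forall y, 'rV[K]_(triv_rank i) -> E y,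
    forall y, triv_dom i y ->
      cancel (triv i (x := y)) (inv y) /\ cancel (inv y) (triv i (x := y)).
  exists (fun y => projT1 (cid (inv_ex y))) => y.
  exact: (projT2 (cid (inv_ex y))).
have chi_smooth_on U : open U -> smooth_on U chi.
  by move=> ?; apply: smooth_on_sub chis => y _.
exists (triv_rank i), chi, (fun k s y => chi y * triv i (s y) 0 k),
  (fun k y => chi y *: inv y (delta_mx 0 k)); split=> //.
- move=> k j l; have Jo := triv_dom_open (j : triv_index E).
  have [T [Ts Te]] := triv_transition i j.
  apply: smooth_on_local => y jy.
  have [iy|niy] := pselect (triv_dom i y).
    exists (triv_dom i `&` triv_dom j).
    have IJo : open (triv_dom i `&` triv_dom j) by exact: openI.
    split=> //; apply: smooth_on_eq
      (smooth_onM IJo (chi_smooth_on _ IJo) (Ts k l)) => // z [iz jz].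
    by rewrite trivZ // (Te z iz jz) (invK z iz).2 -rowE !mxE.
  exists (~` C `&` triv_dom j).
  have CJo : open (~` C `&` triv_dom j).
    by apply: openI => //; exact: closed_openC.
  split=> //; first by split=> // /CU.
  apply: smooth_on_eq (smooth_on_cst 0 CJo) => // z [nCz jz].
  by rewrite (chi0 z nCz) scale0r triv0 // mxE.
- move=> k s ss; apply: (smooth_onT_support Uo Cc CU).
    by move=> y /chi0 ->; rewrite mul0r.
  by apply: smooth_onM => //; exact: chi_smooth_on.
- split=> [k s t ->//|s y].
  have [Cy|nCy] := pselect (C y); last first.
    rewrite (chi0 y nCy) mul0r scale0r big1 // => k _.
    by rewrite mul0r scale0r.
  have iy := CU _ Cy; have [tK Kt] := invK y iy.
  apply: (can_inj tK); rewrite triv_sum // trivZ //.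
  rewrite [in RHS](row_sum_delta (triv i (s y))) scaler_sumr.
  by apply: eq_bigr => k _; rewrite !trivZ // Kt !scalerA mulrAC.
Qed.

(** Freeze the coordinates at x of an arbitrary family through v and use them as
    constant coefficients of the frame. *)
Lemma section_through (x : M) (v : E x) :
  exists2 s : sect E, smooth_section s & s x = v.
Proof.
have [r [chi [co [fr [_ chix frs _ [_ co_fr]]]]]] := bump_frame x.
pose s0 : sect E := fun y =>
  if pselect (x = y) is left xy then ecast z (E z) xy v else 0.
have s0x : s0 x = v.
  rewrite /s0; case: pselect => // xx.
  by rewrite (Prop_irrelevance xx erefl).
exists (fun y => \sum_k co k s0 x *: fr k y).
  apply: smooth_section_sum => k; apply: smooth_sectionZ => //.
  exact: smooth_cst.
by rewrite co_fr chix mulr1 scale1r.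
Qed.

Definition extension (x : M) (v : E x) : sect E :=
  s2val (cid2 (section_through v)).

Lemma extension_smooth (x : M) (v : E x) : smooth_section (extension v).
Proof. exact: s2valP (cid2 (section_through v)). Qed.

Lemma extensionE (x : M) (v : E x) : extension v x = v.
Proof. exact: s2valP' (cid2 (section_through v)). Qed.

(** C^oo-linearity over the evaluation at x. *)
Definition tensorial_at (x : M) (V : lmodType K) (T : sect E -> V) : Prop :=
  forall f s t, smooth f -> smooth_section s -> smooth_section t ->
    T (fun y => f y *: s y + t y) = f x *: T s + T t.

(** Expand chi^2 s in the frame of bump_frame: as chi x = 1, this gives
    T s = sum_k (co k s x) T (fr k), whose right-hand side only sees s x. *)
Lemma tensorial_at_eq (x : M) (V : lmodType K) (T : sect E -> V) :
  tensorial_at x T ->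
  forall s t, smooth_section s -> smooth_section t -> s x = t x -> T s = T t.
Proof.
move=> TDZ.
have T0 : T (fun=> 0) = 0.
  have /eqP := TDZ _ _ _ (smooth_cst 1) smooth_section0 smooth_section0.
  rewrite (_ : (fun y => _) = fun=> 0).
    by rewrite scale1r eq_sym addrC -subr_eq0 addrK => /eqP.
  by apply: eq_sect => y; rewrite scaler0 addr0.
have TZ f s : smooth f -> smooth_section s ->
    T (fun y => f y *: s y) = f x *: T s.
  move=> fs ss; have := TDZ _ _ _ fs ss smooth_section0.
  rewrite T0 addr0 => <-; congr T.
  by apply: eq_sect => y; rewrite addr0.
have Tsum m (c : 'I_m -> M -> K) (F : 'I_m -> sect E) (r : seq 'I_m) :
    (forall k, smooth (c k)) -> (forall k, smooth_section (F k)) ->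
    T (fun y => \sum_(k <- r) c k y *: F k y) = \sum_(k <- r) c k x *: T (F k).
  move=> cs Fs; elim: r => [|k r IHr].
    rewrite big_nil -[RHS]T0; congr T.
    by apply: eq_sect => y; rewrite big_nil.
  rewrite big_cons -IHr -TDZ //; last first.
    by apply: smooth_section_sum => j; exact: smooth_sectionZ.
  by congr T; apply: eq_sect => y; rewrite big_cons.
have [r [chi [co [fr [chis chix frs cos [co_loc co_fr]]]]]] := bump_frame x.
have Tco s : smooth_section s -> T s = \sum_k co k s x *: T (fr k).
  move=> ss; rewrite -(Tsum _ (fun k => co k s)) //;
    last by move=> k; exact: cos.
  transitivity (T (fun y => (chi y * chi y) *: s y)).
    by rewrite TZ ?chix ?mulr1 ?scale1r //; exact: (smooth_onM openT).
  by congr T; apply: eq_sect => y; rewrite co_fr.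
move=> s t ss ts st; rewrite !Tco //.
by apply: eq_bigr => k _; rewrite (co_loc k s t st).
Qed.

Lemma tensorial_at_linear (x : M) (V : lmodType K) (T : sect E -> V)
    (phi : E x -> V) :
  tensorial_at x T -> (forall s, smooth_section s -> phi (s x) = T s) ->
  linear phi.
Proof.
move=> TDZ phiT c u v.
have [[s ss <-] [t ts <-]] := (section_through u, section_through v).
rewrite !phiT // -(TDZ (fun=> c)) //; last exact: smooth_cst.
by rewrite -phiT //; apply: smooth_sectionDZ => //; exact: smooth_cst.
Qed.

End Sections.

(** * Connections and curvature *)

(** In a sum associated to the left, moves the last term t leftwards until it
    meets its opposite. *)
Ltac cancel_last t :=
  match goal with
  | |- context [?S + ?b + t] =>
      first [ rewrite [S + b + t]addrK | rewrite [S + b + t]subrK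
            | rewrite [S + b + t]addrAC; cancel_last t ]
  end.

(** Proves an equality in a module whose two sides agree as formal sums after
    distribution of opposites and scalars. The initial 0 ensures that the first
    term of the sum also has a left neighbour. *)
Ltac zmod_cancel :=
  apply/eqP; rewrite -subr_eq0; apply/eqP; rewrite -[LHS]add0r ?subr0;
  rewrite ?(scaleNr, scalerN, scalerDr, opprD, opprK, addrA);
  repeat match goal with |- ?S + ?t = 0 => cancel_last t end; try reflexivity.

Section Connection.
Context {R : realType} {n : nat} {M : smooth_manifold R n} {g : scalars}.
Local Notation K := (scalar_field R g).
Context {L : lie_algebroid M g} {E : vector_bundle M g}.
Implicit Types (l m u : sect L) (e : sect E) (f : M -> K).

Lemma bracketDl l l' m : smooth_section l -> smooth_section l' ->
  smooth_section m ->
  bracket (fun y => l y + l' y) m = fun y => bracket l m y + bracket l' m y.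
Proof.
move=> sl sl' sm; apply: eq_sect => x; rewrite -[bracket l m x]scale1r.
rewrite -bracket_linear //; congr (bracket _ m x).
by apply: eq_sect => y; rewrite scale1r.
Qed.

Lemma bracket_leibnizl f l l' m : smooth f -> smooth_section l ->
  smooth_section l' -> smooth_section m ->
  bracket (fun y => f y *: l y + l' y) m =
  fun y => (- anchor (m y) f) *: l y + (f y *: bracket l m y + bracket l' m y).
Proof.
move=> sf sl sl' sm; have sfl := smooth_sectionZ sf sl.
rewrite bracketDl //; apply: eq_sect => x.
rewrite bracket_antisym // bracket_leibniz // [bracket m l x]bracket_antisym //.
by zmod_cancel.
Qed.

Lemma bracketNl l m : smooth_section l -> smooth_section m ->
  bracket (fun y => - l y) m = fun y => - bracket l m y.
Proof.
move=> sl sm; have s0 := smooth_section0 (E := L).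
have b0 x : bracket (fun=> 0) m x = 0.
  rewrite -[RHS](addNr (bracket l m x)) -[- _]scaleN1r -bracket_linear //.
  by congr (bracket _ m x); apply: eq_sect => y; rewrite scaleN1r addNr.
apply: eq_sect => x.
rewrite -[RHS]addr0 -(b0 x) -[- _]scaleN1r -bracket_linear //.
by congr (bracket _ m x); apply: eq_sect => y; rewrite scaleN1r addr0.
Qed.

Lemma bracket_jacobi_left l m u : smooth_section l -> smooth_section m ->
  smooth_section u ->
  bracket (bracket l m) u =
  fun y => bracket l (bracket m u) y - bracket m (bracket l u) y.
Proof.
move=> sl sm su; have slm := bracket_smooth sl sm.
have slu := bracket_smooth sl su.
apply: eq_sect => x; have := bracket_jacobi sl sm su x.
have -> : bracket u l = fun y => - bracket l u y.
  by apply: eq_sect => y; exact: bracket_antisym.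
rewrite [bracket m (fun=> _) x]bracket_antisym ?bracketNl //; last first.
  exact: smooth_sectionN.
rewrite opprK [bracket _ m x]bracket_antisym //.
rewrite [bracket u _ x]bracket_antisym //.
by move/eqP; rewrite subr_eq0 => /eqP <-.
Qed.

Section ConnectionTheory.
Context (nabla : sect L -> sect E -> sect E) (Hn : is_connection nabla).

Lemma connection_smooth l e : smooth_section l -> smooth_section e ->
  smooth_section (nabla l e).
Proof. by case: Hn => + _ _ _; exact. Qed.

Lemma connectionDZl f l l' e : smooth f -> smooth_section l ->
  smooth_section l' -> smooth_section e ->
  nabla (fun y => f y *: l y + l' y) e =
  fun y => f y *: nabla l e y + nabla l' e y.
Proof. by case: Hn => _ + _ _ => h *; apply: eq_sect; exact: h. Qed.

Lemma connectionDr l e e' : smooth_section l -> smooth_section e ->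
  smooth_section e' ->
  nabla l (fun y => e y + e' y) = fun y => nabla l e y + nabla l e' y.
Proof. by case: Hn => _ _ + _ => h *; apply: eq_sect; exact: h. Qed.

Lemma connection_leibniz f l e : smooth f -> smooth_section l ->
  smooth_section e ->
  nabla l (fun y => f y *: e y) =
  fun y => f y *: nabla l e y + anchor (l y) f *: e y.
Proof. by case: Hn => _ _ _ + => h *; apply: eq_sect; exact: h. Qed.

Lemma connectionBl l l' e : smooth_section l -> smooth_section l' ->
  smooth_section e ->
  nabla (fun y => l y - l' y) e = fun y => nabla l e y - nabla l' e y.
Proof.
move=> sl sl' se.
have -> : (fun y => l y - l' y) = fun y => -1 *: l' y + l y.
  by apply: eq_sect => y; rewrite scaleN1r addrC.
rewrite connectionDZl //; last exact: smooth_cst.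
by apply: eq_sect => y; rewrite scaleN1r addrC.
Qed.

Lemma connectionBr l e e' : smooth_section l -> smooth_section e ->
  smooth_section e' ->
  nabla l (fun y => e y - e' y) = fun y => nabla l e y - nabla l e' y.
Proof.
move=> sl se se'; apply: eq_sect => x; apply: (addIr (nabla l e' x)).
rewrite subrK; have seB := smooth_sectionB se se'.
transitivity (nabla l (fun y => (e y - e' y) + e' y) x).
  by rewrite (connectionDr sl seB se').
by congr (nabla l _ x); apply: eq_sect => y; rewrite subrK.
Qed.

Lemma connectionNl l e : smooth_section l -> smooth_section e ->
  nabla (fun y => - l y) e = fun y => - nabla l e y.
Proof.
move=> sl se; have s0 := smooth_section0 (E := L).
have n0 x : nabla (fun=> 0) e x = 0.
  transitivity (nabla (fun y => 0 - 0) e x).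
    by congr (nabla _ e x); apply: eq_sect => y; rewrite subr0.
  by rewrite connectionBl // subrr.
transitivity (nabla (fun y => 0 - l y) e).
  by congr (nabla _ e); apply: eq_sect => y; rewrite sub0r.
by rewrite connectionBl //; apply: eq_sect => x; rewrite n0 sub0r.
Qed.

End ConnectionTheory.

Definition curvature (nabla : sect L -> sect E -> sect E) l m e : sect E :=
  fun x => nabla l (nabla m e) x - nabla m (nabla l e) x
    - nabla (bracket l m) e x.

Section Curvature.
Context (nabla : sect L -> sect E -> sect E) (Hn : is_connection nabla).
Local Notation curv := (curvature nabla).

Lemma curvature_smooth l m e : smooth_section l -> smooth_section m ->
  smooth_section e -> smooth_section (curv l m e).
Proof.
move=> sl sm se; have cs := connection_smooth Hn.
apply: smooth_sectionB; first apply: smooth_sectionB.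
- by apply: (cs) => //; exact: cs.
- by apply: (cs) => //; exact: cs.
- by apply: (cs) => //; exact: bracket_smooth.
Qed.

Lemma curvature_antisym l m e x : smooth_section l -> smooth_section m ->
  smooth_section e -> curv l m e x = - curv m l e x.
Proof.
move=> sl sm se; rewrite /curvature.
have -> : bracket l m = fun y => - bracket m l y.
  by apply: eq_sect => y; exact: bracket_antisym.
rewrite (connectionNl Hn) //; first by zmod_cancel.
exact: bracket_smooth.
Qed.

(** The term nabla_m (f nabla_l e) contributes (m f) nabla_l e, which cancels
    against the one from [f l, m] = f [l, m] - (m f) l. *)
Lemma curvature_tensorial1 m e x : smooth_section m -> smooth_section e ->
  tensorial_at x (fun l => curv l m e x).
Proof.
move=> sm se f l l' sf sl sl'; rewrite /curvature.
have cs := connection_smooth Hn.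
have [sme sle sle'] := And3 (cs _ _ sm se) (cs _ _ sl se) (cs _ _ sl' se).
have [slm slm'] := (bracket_smooth sl sm, bracket_smooth sl' sm).
have smf : smooth (fun y => - anchor (m y) f : K).
  by apply: smooth_onN; [exact: openT | exact: anchor_smooth].
have sDZ := smooth_sectionDZ sf slm slm'.
rewrite (bracket_leibnizl sf sl sl' sm) !(connectionDZl Hn) //.
rewrite (connectionDr Hn) // ?(connection_leibniz Hn) //; last first.
  exact: smooth_sectionZ.
by zmod_cancel.
Qed.

(** The first-order terms cancel in pairs; the remaining terms
    (l (m f) - m (l f) - [l, m] f) e vanish because the anchor preserves
    brackets. *)
Lemma curvature_tensorial3 l m x : smooth_section l -> smooth_section m ->
  tensorial_at x (fun e => curv l m e x).
Proof.
move=> sl sm f e e' sf se se'; rewrite /curvature.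
have cs := connection_smooth Hn.
have slm := bracket_smooth sl sm.
have [sme sle] := (cs _ _ sm se, cs _ _ sl se).
have [sme' sle'] := (cs _ _ sm se', cs _ _ sl se').
have [sfe lf mf] :=
  And3 (smooth_sectionZ sf se) (anchor_smooth sl sf) (anchor_smooth sm sf).
have sZ h s : smooth h -> smooth_section s ->
    smooth_section (fun y => h y *: s y : E y) by exact: smooth_sectionZ.
have sDZ := smooth_sectionD (sZ _ _ sf sle) (sZ _ _ lf se).
have sDZ' := smooth_sectionD (sZ _ _ sf sme) (sZ _ _ mf se).
rewrite !(connectionDr Hn) // !(connection_leibniz Hn) //.
rewrite !(connectionDr Hn) // ?(connection_leibniz Hn) //; try exact: sZ.
rewrite anchor_bracket // scalerBl; zmod_cancel.
Qed.

End Curvature.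
End Connection.

(** * The Atiyah class of a module over a Lie pair *)

Section AtiyahClass.
Context {R : realType} {n : nat} {M : smooth_manifold R n} {g : scalars}.
Context (P : lie_pair M g) (E : lie_module (sub P)).
Local Notation K := (scalar_field R g).
Local Notation L := (big P).
Local Notation A := (sub P).
Implicit Types (a b : sect A) (l : sect L) (e : sect E).

Lemma incl_sect_smooth a : smooth_section a -> smooth_section (incl_sect a).
Proof. exact: incl_smooth. Qed.

Lemma incl_sect_bracket a b : smooth_section a -> smooth_section b ->
  incl_sect (bracket a b) = bracket (incl_sect a) (incl_sect b).
Proof. by move=> sa sb; apply: eq_sect => x; exact: incl_bracket. Qed.

Lemma actionBr a e e' : smooth_section a -> smooth_section e ->
  smooth_section e' ->
  mod_action a (fun y => e y - e' y) =
  fun y => mod_action a e y - mod_action a e' y.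
Proof. exact/connectionBr/mod_connection. Qed.

Lemma is_0cochainB (phi psi : forall x, L x -> E x -> E x) :
  is_0cochain phi -> is_0cochain psi ->
  is_0cochain (fun x v w => phi x v w - psi x v w).
Proof.
move=> [phil phis] [psil psis]; split=> [x|l e sl se]; last first.
  exact: (smooth_sectionB (phis _ _ sl se) (psis _ _ sl se)).
have [[p1 p2 p3] [q1 q2 q3]] := (phil x, psil x); split.
- by move=> w c u v; rewrite p1 q1; zmod_cancel.
- by move=> v c u w; rewrite p2 q2; zmod_cancel.
- by move=> u w; rewrite p3 q3 subr0.
Qed.

Lemma is_0cochain0 : is_0cochain (fun (x : M) (_ : L x) (_ : E x) => 0 : E x).
Proof.
split=> [x|l e _ _]; last exact: smooth_section0.
by split=> // w c u v; rewrite scaler0 addr0.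
Qed.

Lemma d0B (phi psi : forall x, L x -> E x -> E x) a l e x :
  is_0cochain phi -> is_0cochain psi -> smooth_section a ->
  smooth_section l -> smooth_section e ->
  d0 (fun x v w => phi x v w - psi x v w) a l e x =
  d0 phi a l e x - d0 psi a l e x.
Proof.
move=> [_ phis] [_ psis] sa sl se; rewrite /d0 /perp_End_action /eval0.
rewrite (actionBr sa (phis _ _ sl se) (psis _ _ sl se)).
by zmod_cancel.
Qed.

Lemma d0_0 a l e x : smooth_section a -> smooth_section l ->
  smooth_section e ->
  d0 (fun x (_ : L x) (_ : E x) => 0 : E x) a l e x = 0.
Proof.
move=> sa sl se; have c0 := is_0cochain0.
have := d0B x c0 c0 sa sl se; rewrite subrr => <-.
congr (d0 _ a l e x).
by do 3!apply: functional_extensionality_dep => ?; rewrite subr0.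
Qed.

Lemma cohomologous_refl (omega : forall x, A x -> L x -> E x -> E x) :
  cohomologous omega omega.
Proof.
exists (fun x _ _ => 0); first exact: is_0cochain0.
by move=> a l e sa sl se x; rewrite subrr d0_0.
Qed.

(** Reflexivity and this Euclidean property make cohomologous an equivalence
    relation. *)
Lemma cohomologous_diff (om1 om2 om3 : forall x, A x -> L x -> E x -> E x) :
  cohomologous om1 om3 -> cohomologous om2 om3 -> cohomologous om1 om2.
Proof.
move=> [phi cphi e13] [psi cpsi e23].
exists (fun x v w => phi x v w - psi x v w); first exact: is_0cochainB.
move=> a l e sa sl se x; rewrite d0B // -e13 // -e23 //.
by zmod_cancel.
Qed.

Lemma cohomologous_sym (om1 om2 : forall x, A x -> L x -> E x -> E x) :
  cohomologous om1 om2 -> cohomologous om2 om1.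
Proof. exact/cohomologous_diff/cohomologous_refl. Qed.

Lemma cohomology_class_eq (om1 om2 : forall x, A x -> L x -> E x -> E x) :
  cohomologous om1 om2 -> cohomology_class om1 = cohomology_class om2.
Proof.
move=> e12; have e21 := cohomologous_sym e12.
by apply/seteqP; split=> om [cz h]; split=> //;
  apply: cohomologous_diff h _.
Qed.

Section Extending.
Context (nabla : sect L -> sect E -> sect E).
Context (Hn : is_connection nabla) (He : extends_action nabla).
Local Notation curv := (curvature nabla).

Lemma extends_actionE a e : smooth_section a -> smooth_section e ->
  nabla (incl_sect a) e = mod_action a e.
Proof. by move=> sa se; apply: eq_sect; exact: He. Qed.

(** On A the connection is the action of the A-module E, which is flat. This is
    why the Atiyah cochain takes values in the annihilator of A. *)
Lemma curvature_flat a b e : smooth_section a -> smooth_section b ->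
  smooth_section e ->
  curv (incl_sect a) (incl_sect b) e = fun=> 0.
Proof.
move=> sa sb se; apply: eq_sect => x; rewrite /curvature -incl_sect_bracket //.
have as_ := connection_smooth (mod_connection E).
have sab := bracket_smooth sa sb.
rewrite !extends_actionE //; try exact: as_.
by rewrite mod_flat // subrr.
Qed.

(** The curvature is tensorial in each argument, so its value on sections
    through given vectors only depends on these vectors. *)
Lemma atiyah_cochain_exists : exists rho, is_atiyah_cochain nabla rho.
Proof.
pose rho x (u : A x) (v : L x) (w : E x) :=
  curv (incl_sect (extension u)) (extension v) (extension w) x : E x.
have [extA extL extE] := And3 (@extension_smooth _ _ _ _ A)
  (@extension_smooth _ _ _ _ L) (@extension_smooth _ _ _ _ E).
have tensA l e x : smooth_section l -> smooth_section e ->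
    tensorial_at x (fun a => curv (incl_sect a) l e x).
  move=> sl se f a a' sf sa sa'.
  rewrite -(curvature_tensorial1 Hn) //; try exact: incl_sect_smooth.
  congr (curv _ l e x); apply: eq_sect => y; exact: incl_linear.
have tensL a e x : smooth_section a -> smooth_section e ->
    tensorial_at x (fun l => curv (incl_sect a) l e x).
  move=> sa se f l l' sf sl sl'; have si := incl_sect_smooth sa.
  rewrite !(curvature_antisym Hn _ si) //; last exact: smooth_sectionDZ.
  by rewrite (curvature_tensorial1 Hn) //; zmod_cancel.
have tensE a l x : smooth_section a -> smooth_section l ->
    tensorial_at x (fun e => curv (incl_sect a) l e x).
  move=> sa sl; apply: (curvature_tensorial3 Hn) => //.
  exact: incl_sect_smooth.
have rhoE a l e x : smooth_section a -> smooth_section l ->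
    smooth_section e ->
    rho x (a x) (l x) (e x) = curv (incl_sect a) l e x.
  move=> sa sl se; rewrite /rho.
  have [sl' se'] := (extension_smooth (l x), extension_smooth (e x)).
  rewrite (tensorial_at_eq (tensA _ _ x sl' se') _ sa) ?extensionE //.
  rewrite (tensorial_at_eq (tensL _ _ x sa se') _ sl) ?extensionE //.
  by rewrite (tensorial_at_eq (tensE _ _ x sa sl) _ se) ?extensionE.
exists rho; split; last by move=> *; exact: rhoE.
split.
- move=> x v w; rewrite -[v]extensionE -[w]extensionE.
  apply: (tensorial_at_linear (tensA _ _ x (extL _ v) (extE _ w))) => a sa.
  exact: rhoE.
- move=> x u; rewrite -[u]extensionE; split.
  + move=> w; rewrite -[w]extensionE.
    apply: (tensorial_at_linear (tensL _ _ x (extA _ u) (extE _ w))) => l sl.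
    exact: rhoE.
  + move=> v; rewrite -[v]extensionE.
    apply: (tensorial_at_linear (tensE _ _ x (extA _ u) (extL _ v))) => e se.
    exact: rhoE.
  + move=> u' w; rewrite -[w]extensionE -[u']extensionE.
    rewrite -[Defs.incl _]/(incl_sect (extension u') x) rhoE //;
      last exact: incl_sect_smooth.
    by rewrite curvature_flat.
- move=> a l e sa sl se.
  have sc := curvature_smooth Hn (incl_sect_smooth sa) sl se.
  by congr smooth_section: sc; apply: eq_sect => x; rewrite rhoE.
Qed.

(** Both cochains are determined on smooth sections, and these pass through all
    vectors. *)
Lemma atiyah_cochain_unique rho rho' : is_atiyah_cochain nabla rho ->
  is_atiyah_cochain nabla rho' -> rho = rho'.
Proof.
move=> [_ h] [_ h']; apply: functional_extensionality_dep => x.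
apply/funext => u; apply/funext => v; apply/funext => w.
rewrite -[u]extensionE -[v]extensionE -[w]extensionE.
by rewrite h ?h' //; exact: extension_smooth.
Qed.

Lemma curvature_extends a l e : smooth_section a -> smooth_section l ->
  smooth_section e ->
  curv (incl_sect a) l e = fun x => mod_action a (nabla l e) x
    - nabla l (mod_action a e) x - nabla (bracket (incl_sect a) l) e x.
Proof.
move=> sa sl se; apply: eq_sect => x; rewrite /curvature !extends_actionE //.
exact: (connection_smooth Hn).
Qed.

(** Bianchi identity with two arguments in A: after expansion, flatness rewrites
    nabla_[a, b] as a commutator and the Jacobi identity rewrites [[a, b], l];
    all terms then cancel in pairs. *)
Lemma atiyah_cochain_cocycle rho : is_atiyah_cochain nabla rho ->
  is_1cocycle rho.
Proof.
move=> [rho_cochain rhoE]; split=> // a b l e sa sb sl se x.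
have {}rhoE c m s : smooth_section c -> smooth_section m -> smooth_section s ->
    eval0 (Defs.contract rho c) m s = curv (incl_sect c) m s.
  by move=> sc sm ss; apply: eq_sect => y; exact: rhoE.
have [sia sib] := (incl_sect_smooth sa, incl_sect_smooth sb).
have [sab sal sbl] :=
  And3 (bracket_smooth sa sb) (bracket_smooth sia sl) (bracket_smooth sib sl).
have sact c s : smooth_section c -> smooth_section s ->
  smooth_section (mod_action c s : sect E).
  exact: (connection_smooth (mod_connection E)).
have snab := connection_smooth Hn.
have [sae sbe snl] := And3 (sact _ _ sa se) (sact _ _ sb se) (snab _ _ sl se).
rewrite /d1 /perp_End_action !rhoE // !curvature_extends //.
have actBB c p q r : smooth_section c -> smooth_section p ->
    smooth_section q -> smooth_section r ->
    mod_action c (fun y => p y - q y - r y : E y) =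
    fun y => mod_action c p y - mod_action c q y - mod_action c r y.
  move=> sc sp sq sr; have spq := smooth_sectionB sp sq.
  by rewrite (actionBr sc spq sr) (actionBr sc sp sq).
have flatE s : smooth_section s -> mod_action (bracket a b) s =
    fun y => mod_action a (mod_action b s) y - mod_action b (mod_action a s) y.
  by move=> ss; apply: eq_sect => y; rewrite mod_flat.
rewrite !actBB //; try by [exact: sact | exact: snab].
rewrite !flatE // (connectionBr Hn) //; try exact: sact.
rewrite incl_sect_bracket // bracket_jacobi_left // (connectionBl Hn) //;
  try exact: bracket_smooth.
by zmod_cancel.
Qed.

End Extending.

(** The two derivative terms of the Leibniz rule are equal and cancel, so the
    difference is tensorial; it vanishes on A, where both connections are the
    action. *)
Lemma connection_difference nabla nabla' :
  is_connection nabla -> extends_action nabla ->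
  is_connection nabla' -> extends_action nabla' ->
  exists2 phi : forall x, L x -> E x -> E x, is_0cochain phi &
    forall l e, smooth_section l -> smooth_section e ->
      forall x, phi x (l x) (e x) = nabla' l e x - nabla l e x.
Proof.
move=> Hn He Hn' He'.
pose D l e : sect E := fun x => nabla' l e x - nabla l e x.
have tensL e x : smooth_section e -> tensorial_at x (fun l => D l e x).
  move=> se f l l' sf sl sl'.
  rewrite /D (connectionDZl Hn) // (connectionDZl Hn') //.
  by zmod_cancel.
have tensE l x : smooth_section l -> tensorial_at x (fun e => D l e x).
  move=> sl f e e' sf se se'; have sfe := smooth_sectionZ sf se.
  rewrite /D (connectionDr Hn) // (connectionDr Hn') //.
  rewrite (connection_leibniz Hn) // (connection_leibniz Hn') //.
  by zmod_cancel.
pose phi x (v : L x) (w : E x) := D (extension v) (extension w) x : E x.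
have [extL extE] := (@extension_smooth _ _ _ _ L, @extension_smooth _ _ _ _ E).
have phiE l e x : smooth_section l -> smooth_section e ->
    phi x (l x) (e x) = D l e x.
  move=> sl se; have [sl' se'] := (extL _ (l x), extE _ (e x)); rewrite /phi.
  rewrite (tensorial_at_eq (tensL _ x se') _ sl) ?extensionE //.
  by rewrite (tensorial_at_eq (tensE _ x sl) _ se) ?extensionE.
exists phi; last by move=> *; exact: phiE.
split=> [x|l e sl se].
  split.
  - move=> w; rewrite -[w]extensionE.
    apply: (tensorial_at_linear (tensL _ x (extE _ w))) => l sl.
    exact: phiE.
  - move=> v; rewrite -[v]extensionE.
    apply: (tensorial_at_linear (tensE _ x (extL _ v))) => e se.
    exact: phiE.
  - move=> u w; rewrite -[u]extensionE -[w]extensionE.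
    have sa := extension_smooth u; have sw := extE _ w.
    rewrite -[Defs.incl _]/(incl_sect (extension u) x) phiE //; last first.
      exact: incl_sect_smooth.
    by rewrite /D He // He' // subrr.
have [snl snl'] := (connection_smooth Hn sl se, connection_smooth Hn' sl se).
have := smooth_sectionB snl' snl.
by congr smooth_section; apply: eq_sect => x; rewrite phiE.
Qed.

(** The curvature on A x L is affine in the connection: nabla_a is fixed by the
    action, so [nabla_a, nabla_l] - nabla_[a, l] is linear in the remaining
    occurrences of nabla, and its linear part is d. *)
Lemma d0_connection_difference nabla nabla' (phi : forall x, L x -> E x -> E x)
    a l e x :
  is_connection nabla -> extends_action nabla ->
  is_connection nabla' -> extends_action nabla' ->
  (forall l e, smooth_section l -> smooth_section e ->
    forall x, phi x (l x) (e x) = nabla' l e x - nabla l e x) ->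
  smooth_section a -> smooth_section l -> smooth_section e ->
  d0 phi a l e x =
  curvature nabla' (incl_sect a) l e x - curvature nabla (incl_sect a) l e x.
Proof.
move=> Hn He Hn' He' phiE sa sl se.
have {}phiE m s : smooth_section m -> smooth_section s ->
    eval0 phi m s = fun y => nabla' m s y - nabla m s y.
  by move=> sm ss; apply: eq_sect => y; exact: phiE.
have sal := bracket_smooth (incl_sect_smooth sa) sl.
have sae := connection_smooth (mod_connection E) sa se.
have [snl snl'] := (connection_smooth Hn sl se, connection_smooth Hn' sl se).
rewrite /d0 /perp_End_action !phiE // (actionBr sa snl' snl).
rewrite (curvature_extends Hn) // (curvature_extends Hn') //.
by zmod_cancel.
Qed.

(** Connections that extend the action form an affine space over the sections of
    Aperp (x) End E; the annihilation of A keeps the translate an extension of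
    the action. *)
Lemma connection_translate nabla (phi : forall x, L x -> E x -> E x) :
  is_connection nabla -> extends_action nabla -> is_0cochain phi ->
  let nabla0 : sect L -> sect E -> sect E :=
    fun l e x => nabla l e x - phi x (l x) (e x) in
  is_connection nabla0 /\ extends_action nabla0.
Proof.
move=> Hn He [phil phis] nabla0; split; last first.
  move=> a e sa se x; rewrite /nabla0 He //.
  by have [_ _ phiA] := phil x; rewrite [phi _ _ _]phiA subr0.
split.
- move=> l e sl se.
  exact: (smooth_sectionB (connection_smooth Hn sl se) (phis _ _ sl se)).
- move=> f l l' e sf sl sl' se x; rewrite /nabla0 (connectionDZl Hn) //.
  by have [phiL _ _] := phil x; rewrite phiL; zmod_cancel.
- move=> l e e' sl se se' x; rewrite /nabla0 (connectionDr Hn) //.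
  have [_ phiE _] := phil x.
  by rewrite -[e x]scale1r phiE !scale1r; zmod_cancel.
- move=> f l e sf sl se x; rewrite /nabla0 (connection_leibniz Hn) //.
  have [_ phiE _] := phil x.
  have phi0 : phi x (l x) 0 = 0.
    have := phiE (l x) (-1) 0 0.
    by rewrite scaler0 addr0 scaleN1r addNr.
  by rewrite -[f x *: e x]addr0 phiE phi0 addr0; zmod_cancel.
Qed.

Lemma A_compatible_zero nabla : is_connection nabla -> A_compatible nabla ->
  is_atiyah_cochain nabla (@zero_cochain _ _ _ _ P E).
Proof.
move=> Hn [He Hc]; split=> [|a l e sa sl se x]; last first.
  by rewrite Hc // subrr.
split=> [x v w c u v'|x u|a l e _ _ _]; last exact: smooth_section0.
  by rewrite /zero_cochain scaler0 addr0.
by split=> // ? c ? ?; rewrite /zero_cochain scaler0 addr0.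
Qed.

Lemma atiyah_class_indep nabla nabla'
    (rho rho' : forall x, A x -> L x -> E x -> E x) :
  is_connection nabla -> extends_action nabla -> is_atiyah_cochain nabla rho ->
  is_connection nabla' -> extends_action nabla' ->
  is_atiyah_cochain nabla' rho' ->
  cohomologous rho rho'.
Proof.
move=> Hn He [_ rhoE] Hn' He' [_ rhoE'].
have [phi cphi phiE] := connection_difference Hn' He' Hn He.
exists phi => // a l e sa sl se x.
by rewrite (d0_connection_difference x Hn' He' Hn He phiE) // rhoE // rhoE'.
Qed.

End AtiyahClass.

Theorem theorem2p5 (R : realType) (n : nat) (M : smooth_manifold R n)
    (g : scalars) (P : lie_pair M g) (E : lie_module (sub P)) :
  (* R^nabla is a well-defined section *)
  (forall nabla : sect (big P) -> sect E -> sect E,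
    is_connection nabla -> extends_action nabla ->
    exists! rho, is_atiyah_cochain nabla rho) /\
  (* (a) *)
  (forall (nabla : sect (big P) -> sect E -> sect E) rho,
    is_connection nabla -> extends_action nabla ->
    is_atiyah_cochain nabla rho ->
    is_1cocycle rho) /\
  (* (b) *)
  (forall (nabla nabla' : sect (big P) -> sect E -> sect E) rho rho',
    is_connection nabla -> extends_action nabla ->
    is_atiyah_cochain nabla rho ->
    is_connection nabla' -> extends_action nabla' ->
    is_atiyah_cochain nabla' rho' ->
    cohomology_class rho = cohomology_class rho') /\
  (* (c) *)
  (forall (nabla : sect (big P) -> sect E -> sect E) rho,
    is_connection nabla -> extends_action nabla ->
    is_atiyah_cochain nabla rho ->
    (cohomology_class rho = cohomology_class (@zero_cochain _ _ _ _ P E) <->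
     exists nabla0 : sect (big P) -> sect E -> sect E,
       is_connection nabla0 /\ A_compatible nabla0)).

Proof.
split=> [nabla Hn He|].
  have [rho rhoA] := atiyah_cochain_exists Hn He.
  exists rho; split=> // rho'; exact: atiyah_cochain_unique.
split=> [nabla rho Hn He|]; first exact: atiyah_cochain_cocycle.
split=> [nabla nabla' rho rho' Hn He rhoA Hn' He' rhoA'|nabla rho Hn He rhoA].
  by apply: cohomology_class_eq; exact: (atiyah_class_indep Hn He rhoA Hn' He').
split=> [class0|[nabla0 [Hn0 Hc0]]]; last first.
  apply: cohomology_class_eq; have [He0 _] := Hc0.
  by apply: (atiyah_class_indep Hn He rhoA Hn0 He0); exact: A_compatible_zero.
have [_ [phi cphi rho_phi]] : cohomology_class (@zero_cochain _ _ _ _ P E) rho.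
  rewrite -class0; split; last exact: cohomologous_refl.
  exact: (atiyah_cochain_cocycle Hn He).
pose nabla0 : sect (big P) -> sect E -> sect E :=
  fun l e x => nabla l e x - phi x (l x) (e x).
have [Hn0 He0] : is_connection nabla0 /\ extends_action nabla0.
  exact: connection_translate.
exists nabla0; split=> //; split=> // a l e sa sl se x.
apply/eqP; rewrite -subr_eq0; apply/eqP.
rewrite -[LHS]/(curvature nabla0 (incl_sect a) l e x).
have phiE m s : smooth_section m -> smooth_section s -> forall y,
    phi y (m y) (s y) = nabla m s y - nabla0 m s y.
  by move=> _ _ y; rewrite /nabla0 opprB addrC subrK.
have := d0_connection_difference x Hn0 He0 Hn He phiE sa sl se.
have [_ rhoE] := rhoA.
rewrite -rho_phi // /zero_cochain subr0 rhoE // => curvB.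
apply: oppr_inj; apply: (addrI (curvature nabla (incl_sect a) l e x)).
by rewrite -curvB oppr0 addr0.
Qed.
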